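(* Let $d\ge1$ be a constant and $C>0$ a constant. Consider the store-and-forward packet routing problem on a $d$-dimensional uni-directional grid $G$ with $n$ nodes, uniform link capacity $c$ and uniform buffer size $B$. Let $\nu = 2n(d+B/c)$, $p_{\max} = (\nu+2)\cdot\mathrm{diam}(G)$ and $k=\lceil \log_2(1+3p_{\max})\rceil$. If $B/c \le n^{C}$ and $B, c \ge k$, then there exists an online deterministic centralized packet-routing algorithm with competitive ratio $O(\log n)$ in which every packet is either rejected upon arrival or delivered (no packet is preempted).
   Context: Store-and-forward packet routing model. The network is a directed graph $G=(V,E)$ with $n=|V|$ nodes; each edge can carry at most $c$ packets per time step (traversal takes one time step); each node can store at most $B$ packets. Time is discrete and synchronous. Each request $r_i=(a_i,b_i,t_i,d_i)$ has source $a_i$, destination $b_i$, input time $t_i$ (the packet is input at $a_i$ via a local input; any number per node per step) and deadline $d_i$ (possibly $\infty$). In each time step each node delivers packets destined to it, forwards at most $c$ of the other present packets along each outgoing edge, stores at most $B$, and deletes the rest. Deleting a locally input packet is rejection; deleting an injected packet before delivery is preemption. Throughput = number of packets delivered by their deadline. An online algorithm learns nothing about $r_i$ before $t_i$. A deterministic online ALG is $\rho$-competitive if $|\mathrm{ALG}(\sigma)|\ge\frac1\rho|\mathrm{OPT}(\sigma)|$ for all inputs $\sigma$, with $|\mathrm{OPT}(\sigma)|$ the maximum achievable throughput. A $d$-dimensional uni-directional grid has vertex set $[\ell_1]\times\cdots\times[\ell_d]$, $n=\prod_j\ell_j$, with a directed edge from $x$ to $x+e_j$ for each coordinate $j$ whenever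 both are vertices; requests satisfy $a_i\le b_i$ coordinatewise. $\mathrm{diam}(G)$ is the maximum over pairs $u,v$ with a directed path from $u$ to $v$ of the length of a shortest such path. *)

(* Defs.v *)
From Stdlib Require Import Reals ClassicalEpsilon.
From HB Require Import structures.
From mathcomp Require Import all_boot.

Set Implicit Arguments.
Unset Strict Implicit.
Unset Printing Implicit Defensive.

(* a point of Z^d (coordinates 0-based: [l] = {0,...,l-1}) *)
Definition node (d : nat) := {ffun 'I_d -> nat}.

Definition in_grid d (l : 'I_d -> nat) (x : node d) : bool :=
  [forall j, x j < l j].

Definition unit_step d (x : node d) (j : 'I_d) : node d :=
  [ffun i => x i + (i == j)].

Definition gedge d (l : 'I_d -> nat) (x y : node d) : bool :=
  [&& in_grid l x, in_grid l y & [exists j, y == unit_step x j]].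

Definition grid_size d (l : 'I_d -> nat) : nat := \prod_(j < d) l j.

Fixpoint gpath d (l : 'I_d -> nat) (k : nat) (u v : node d) : Prop :=
  match k with
  | 0 => u = v
  | k'.+1 => exists w, gedge l u w /\ gpath l k' w v
  end.

Definition shortest d (l : 'I_d -> nat) (u v : node d) (k : nat) : Prop :=
  gpath l k u v /\ forall k', gpath l k' u v -> k <= k'.

Definition is_diam d (l : 'I_d -> nat) (D : nat) : Prop :=
  (exists u v, [/\ in_grid l u, in_grid l v & shortest l u v D]) /\
  (forall u v k, in_grid l u -> in_grid l v -> shortest l u v k -> k <= D).

(* r = (a, b, t, deadline); deadline None = infinity *)
Record request (d : nat) := Request {
  src : node d;
  dst : node d;
  arr : nat;
  ddl : option nat }.

Definition req0 d : request d := Request [ffun => 0] [ffun => 0] 0 None.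

Definition req_at d (s : seq (request d)) (i : nat) : request d :=
  nth (req0 d) s i.

Definition valid_request d (l : 'I_d -> nat) (r : request d) : bool :=
  [&& in_grid l (src r), in_grid l (dst r) & [forall j, src r j <= dst r j]].

Definition valid_input d (l : 'I_d -> nat) (s : seq (request d)) : bool :=
  all (valid_request l) s && sorted (fun r1 r2 => arr r1 <= arr r2) s.

(* X i t = Some v : packet of request i is present at node v at (the start
   of) time step t; None : not (or no longer) present in the network *)
Definition execution d := nat -> nat -> option (node d).

(* feasibility of an execution in the store-and-forward model with link
   capacity c and buffer size B:
   - packet i appears at a_i at time t_i;
   - a packet at its destination is delivered (leaves the network);
   - otherwise at each step it is forwarded along an outgoing edge, stored
     at the same node, or deleted (and then never reappears);
   - at most c packets traverse each edge per step, and at most B packets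
     are stored at each node per step. *)
Definition feasible d (l : 'I_d -> nat) (c B : nat) (s : seq (request d))
    (X : execution d) : Prop :=
  (forall i, i < size s ->
     let r := req_at s i in
     [/\ forall t, t < arr r -> X i t = None,
         X i (arr r) = Some (src r) &
         forall t w, arr r <= t -> X i t.+1 = Some w ->
           exists v, [/\ X i t = Some v, v != dst r & (w = v \/ gedge l v w)]])
  /\ (forall t v w, gedge l v w ->
        \sum_(i < size s) ((X i t == Some v) && (X i t.+1 == Some w)) <= c)
  /\ (forall t v,
        \sum_(i < size s) ((X i t == Some v) && (X i t.+1 == Some v)) <= B).

Definition delivered d (s : seq (request d)) (X : execution d) (i : nat) : Prop :=
  exists t, X i t = Some (dst (req_at s i)).

Definition delivered_by_deadline d (s : seq (request d)) (X : execution d)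
    (i : nat) : Prop :=
  exists t, X i t = Some (dst (req_at s i)) /\
            (if ddl (req_at s i) is Some dl then t <= dl else true).

Definition pbool (P : Prop) : bool :=
  if excluded_middle_informative P then true else false.

Definition throughput d (s : seq (request d)) (X : execution d) : nat :=
  \sum_(i < size s) pbool (delivered_by_deadline s X i).

Definition rejected_on_arrival d (s : seq (request d)) (X : execution d)
    (i : nat) : Prop :=
  src (req_at s i) != dst (req_at s i) /\ X i (arr (req_at s i)).+1 = None.

Definition no_preemption d (s : seq (request d)) (X : execution d) : Prop :=
  forall i, i < size s -> rejected_on_arrival s X i \/ delivered s X i.

(* A deterministic algorithm maps each input to an execution.  It is online
   if the movements up to (the end of) step t depend only on the requests
   input up to time t: two inputs with the same requests of input time <= t
   yield identical positions of those packets at all times <= t+1. *)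
Definition online d (l : 'I_d -> nat) (ALG : seq (request d) -> execution d)
  : Prop :=
  forall s s' t, valid_input l s -> valid_input l s' ->
    [seq r <- s | arr r <= t] = [seq r <- s' | arr r <= t] ->
    forall i, i < size [seq r <- s | arr r <= t] ->
    forall u, u <= t.+1 -> ALG s i u = ALG s' i u.

Section Params.
Local Open Scope R_scope.

Definition Rceil (x : R) : Z := (- Int_part (Ropp x))%Z.

Definition log2R (x : R) : R := ln x / ln 2.

Definition nu_par (n d B c : nat) : R :=
  2 * INR n * (INR d + INR B / INR c).

Definition pmax_par (n d B c D : nat) : R := (nu_par n d B c + 2) * INR D.

Definition k_par (n d B c D : nat) : nat :=
  Z.to_nat (Rceil (log2R (1 + 3 * pmax_par n d B c D))).

End Params.

(* Main.v *)
Require Import Defs.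
From Stdlib Require Import Reals Lra ZArith ClassicalEpsilon.
From HB Require Import structures.
From mathcomp Require Import all_boot all_order all_algebra.
From mathcomp Require Import zify.

Set Implicit Arguments.
Unset Strict Implicit.
Unset Printing Implicit Defensive.

(* Routing is online path packing in the space-time graph. A space-time edge of
   capacity u and load m gets the weight ((1 + k/u)^m - 1) / P, and a request is
   accepted iff it has a route of length at most P and total weight at most 1.
   A saturated edge weighs more than 1, because (1 + k/u)^u >= 2^k > P + 1, so
   capacities are respected; and each acceptance raises the potential
   sum_e u_e w_e by at most 2k.

   Let N = n (B + d c) bound the number of undelivered packets present at any
   time, let W be about N D / c and P = W + D. A packet which a competing schedule
   delivers more than P steps after its input is split into W equal parts: part
   T < W follows it for T steps and then a shortest path to its destination, which
   meets the deadline. The direct portions put an average load of at most N D / W,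
   hence at most c, on each link, so the short routes form a fractional packing of
   load at most twice the capacities. All routes of a rejected request have final
   weight above 1, so the number of packets missed by the algorithm is at most
   2 sum_e u_e w_e <= 4k * accepted. *)

(** * The parameter k *)

Lemma Rceil_lb x : Rle x (IZR (Rceil x)).
Proof.
rewrite /Rceil opp_IZR; have [] := base_Int_part (Ropp x); lra.
Qed.

Lemma Rceil_le x (m : nat) : Rle x (INR m) -> (Z.to_nat (Rceil x) <= m)%N.
Proof.
move=> xm; apply/leP; apply/Nat2Z.inj_le.
rewrite /Rceil; have [_ lt1] := base_Int_part (Ropp x).
have /lt_IZR h : Rlt (IZR (- Int_part (Ropp x))) (IZR (Z.of_nat m + 1)).
  by rewrite opp_IZR plus_IZR -INR_IZR_INZ; lra.
have h0 := Nat2Z.is_nonneg m.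
case: (Z.le_gt_cases 0 (- Int_part (Ropp x))) => h1.
  by rewrite Z2Nat.id //; apply/Z.lt_succ_r.
have -> : Z.to_nat (- Int_part (Ropp x)) = 0%N by case: (Z.opp _) h1 => // p /Z.gt_lt.
exact: h0.
Qed.

Lemma INR_expn (m k : nat) : INR (m ^ k)%N = pow (INR m) k.
Proof. by elim: k => // k IH; rewrite expnS mult_INR IH. Qed.

Lemma ln2_gt0 : Rlt 0 (ln 2).
Proof. by rewrite -ln_1; apply: ln_increasing; lra. Qed.

Lemma log2R_le y (k : nat) : Rlt 0 y -> Rle (log2R y) (INR k) <-> Rle y (pow 2 k).
Proof.
have l2 := ln2_gt0; have p2 : Rlt 0 (pow 2 k) by apply: pow_lt; lra.
move=> y0; rewrite /log2R -[Rle (_ / _) _]/(Rle (Rdiv (ln y) (ln 2)) _).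
have -> : Rle (ln y / ln 2) (INR k) <-> Rle (ln y) (ln (pow 2 k)).
  rewrite ln_pow; last lra; split=> h.
    have := Rmult_le_compat_r _ _ _ (Rlt_le _ _ l2) h; rewrite /Rdiv Rmult_assoc Rinv_l; lra.
  apply: (Rmult_le_reg_r (ln 2)) => //; rewrite /Rdiv Rmult_assoc Rinv_l; lra.
split=> [|/Rle_lt_or_eq_dec[/(ln_increasing _ _ y0)/Rlt_le//|->]]; last by right.
move=> h; case: (Rle_lt_dec y (pow 2 k)) => // /(ln_increasing _ _ p2); lra.
Qed.

Lemma pmax_par_ge0 n d B c D : (0 < c)%N -> Rle 0 (pmax_par n d B c D).
Proof.
move=> c0; have c1 : Rlt 0 (INR c) by apply: lt_0_INR; apply/ltP.
rewrite /pmax_par /nu_par; have := (pos_INR n, pos_INR d, pos_INR B, pos_INR D).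
move=> [[[n0 d0] B0] D0].
apply: Rmult_le_pos => //; have := Rinv_0_lt_compat _ c1; rewrite /Rdiv.
move=> /Rlt_le/(Rmult_le_pos _ _ B0) h.
by have := Rmult_le_pos _ _ n0 (Rplus_le_le_0_compat _ _ d0 h); lra.
Qed.

(** The choice of k gives [1 + 3 * pmax <= 2 ^ k]; multiplying by [c] clears the quotient [B / c]
    and leaves a bound in [nat]. *)
Lemma k_par_lower n d B c D : (0 < c)%N ->
  (c + 6 * (n * (d * c + B) + c) * D <= 2 ^ k_par n d B c D * c)%N.
Proof.
move=> c0; have c1 : Rlt 0 (INR c) by apply: lt_0_INR; apply/ltP.
have p0 := pmax_par_ge0 n d B D c0.
apply/leP/INR_le; rewrite !(plus_INR, mult_INR) INR_expn.
have h : Rle (1 + 3 * pmax_par n d B c D) (pow 2 (k_par n d B c D)).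
  apply/log2R_le; first lra.
  apply: Rle_trans (Rceil_lb _) _.
  rewrite INR_IZR_INZ /k_par; apply: IZR_le.
  by case: (Rceil _) => //= p; rewrite ?positive_nat_Z; apply: Z.le_refl || by [].
have := Rmult_le_compat_r _ _ _ (Rlt_le _ _ c1) h.
have -> : INR 0 = IZR 0 by [].
have -> : INR 2 = IZR 2 by rewrite INR_IZR_INZ.
move=> {}h; apply: Rle_trans h; right.
rewrite /pmax_par /nu_par; field; lra.
Qed.

(** With [n < 2 ^ b], every factor of [1 + 3 * pmax] is at most a fixed power of [2 ^ b], so its
    binary logarithm is linear in [b]. *)
Lemma k_par_upper n d B c D M :
  (0 < n)%N -> (0 < c)%N -> (D <= d * n)%N -> Rle (INR B / INR c) (INR (n ^ M)) ->
  (k_par n d B c D <= (2 * d + M + 9) * (trunc_log 2 n).+1)%N.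
Proof.
move=> n0 c0 leD leB; set b := (trunc_log 2 n).+1.
apply: Rceil_le; apply/log2R_le; first by have := pmax_par_ge0 n d B D c0; lra.
have ln : (n <= 2 ^ b)%N by apply/ltnW/trunc_log_ltn.
have ld : (d <= 2 ^ (d * b))%N.
  apply: (leq_trans (ltnW (ltn_expl d (isT : 1 < 2)))).
  by rewrite leq_exp2l // leq_pmulr.
have b1 : (2 <= 2 ^ b)%N by rewrite -{1}(expn1 2) leq_exp2l.
have key : (1 + 3 * ((2 * n * (d + n ^ M) + 2) * (d * n)) <= 2 ^ ((2 * d + M + 9) * b))%N.
  have nM : (n ^ M <= 2 ^ (M * b))%N by rewrite mulnC expnM; case: (M) => // M1; rewrite leq_exp2r.
  (* Exponents are counted in units of [b]: a product adds them, and a sum costs one unit more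
     because [2 <= 2 ^ b]. *)
  have add (x y i j : nat) : (x <= 2 ^ (i * b) -> y <= 2 ^ (j * b) ->
      x + y <= 2 ^ ((i + j).+1 * b))%N.
    move=> hx hy; rewrite mulSn expnD.
    apply: (leq_trans _ (leq_mul b1 (leqnn _))).
    rewrite mul2n -addnn leq_add // ?(leq_trans hx) ?(leq_trans hy) // leq_exp2l // leq_mul2r.
      by rewrite leq_addr orbT.
    by rewrite leq_addl orbT.
  have mul (x y i j : nat) : (x <= 2 ^ (i * b) -> y <= 2 ^ (j * b) ->
      x * y <= 2 ^ ((i + j) * b))%N.
    by move=> hx hy; rewrite mulnDl expnD leq_mul.
  (* The right-hand side shows the exponent as the [add] and [mul] steps below assemble it. *)
  have -> : (2 * d + M + 9 = (0 + (2 + ((1 + 1 + (d + M).+1) + 1).+1 + (d + 1))).+1)%N.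
    by lia.
  apply: (add 1 _ 0)%N; first by rewrite expn_gt0.
  rewrite mulnA; apply: (mul); last by apply: (mul d n d 1); rewrite ?mul1n.
  apply: (mul 3 _ 2)%N.
    by apply: (@leq_trans (2 ^ 2)%N) => //; rewrite leq_exp2l // leq_pmulr.
  apply: (add _ 2 _ 1)%N => //; last by rewrite mul1n.
  by apply: (mul (2 * n) _ (1 + 1) (d + M).+1)%N; [apply: (mul 2 n 1 1); rewrite mul1n | exact: add].
have /leP/le_INR := key; rewrite INR_expn.
have -> : INR 2 = IZR 2 by rewrite INR_IZR_INZ.
apply: Rle_trans; rewrite plus_INR !mult_INR plus_INR !mult_INR plus_INR.
have -> : INR 3 = IZR 3 by rewrite INR_IZR_INZ.
have -> : INR 2 = IZR 2 by rewrite INR_IZR_INZ.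
have -> : INR 1 = IZR 1 by rewrite INR_IZR_INZ.
apply: Rplus_le_compat_l; apply: Rmult_le_compat_l; first lra.
have := pos_INR n; have := pos_INR d; have := pos_INR (n ^ M)%N => h1 h2 h3.
rewrite /pmax_par /nu_par -mult_INR; apply: Rmult_le_compat.
- have c1 : Rlt 0 (INR c) by apply: lt_0_INR; apply/ltP.
  have := Rinv_0_lt_compat _ c1; rewrite /Rdiv => /Rlt_le/(Rmult_le_pos _ _ (pos_INR B)) h.
  by have := Rmult_le_pos _ _ h3 (Rplus_le_le_0_compat _ _ h2 h); lra.
- exact: pos_INR.
- apply: Rplus_le_compat_r; apply: Rmult_le_compat_l; lra.
- by apply: le_INR; apply/leP.
Qed.

Lemma Rpower_le_expn n C : (0 < n)%N ->
  Rle (Rpower (INR n) C) (INR (n ^ Z.to_nat (Rceil C))).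
Proof.
move=> n0; have n1 : Rle 1 (INR n) by apply: (le_INR 1); apply/leP.
rewrite INR_expn -Rpower_pow; last lra.
apply: Rle_Rpower => //; apply: Rle_trans (Rceil_lb _) _.
rewrite INR_IZR_INZ; apply: IZR_le.
by case: (Rceil _) => //= p; rewrite ?positive_nat_Z; apply: Z.le_refl || by [].
Qed.

(** This is [(1 + k/u)^u >= 2^k] without division: the binomial expansions of [(1 + 1)^k] and
    [(u + k)^u] are compared term by term. *)
Lemma expn_add_ge u k : (k <= u)%N -> (2 ^ k * u ^ u <= (u + k) ^ u)%N.
Proof.
(* After multiplication by [j!] both sides are products over [i < j], and
   [(k - i) * u <= (u - i) * k] factor by factor. *)
move=> ku; have term j : ('C(k, j) * u ^ j <= 'C(u, j) * k ^ j)%N.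
  rewrite -(leq_pmul2r (fact_gt0 j)) mulnAC bin_ffact mulnAC bin_ffact.
  elim: j => // j IH; rewrite !ffactnSr !expnSr mulnACA [leqRHS]mulnACA leq_mul //.
  by rewrite !mulnBl [(k * u)%N]mulnC leq_sub2l // leq_mul2l ku orbT.
rewrite expnDn -[2]/(1 + 1)%N expnDn big_distrl /=.
rewrite (big_ord_widen u.+1 (fun i => 'C(k, i) * (1 ^ (k - i) * 1 ^ i) * u ^ u)%N) //.
rewrite big_mkcond leq_sum //= => i _; case: ifP => // _.
have -> : (u ^ u = u ^ (u - i) * u ^ i)%N by rewrite -expnD subnK // -ltnS.
rewrite !exp1n !muln1 mulnCA [leqRHS]mulnCA.
by rewrite leq_mul2l term orbT.
Qed.

From mathcomp Require Import ring.

(** * Trajectories in space-time *)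

Section Trajectories.
Variable V : eqType.
Implicit Types (x v w : V) (p q : seq V) (a t : nat).

(** A triple [(t, v, w)] is the move from [v] to [w] during step [t]; the case [v = w] is one step
    of storage. *)
Fixpoint stedges a x p : seq (nat * V * V) :=
  if p is w :: p' then (a, x, w) :: stedges a.+1 w p' else [::].

(** Past the end of the list [onth] returns [None], so the packet leaves the network after its last
    node. *)
Definition position a x p t : option V :=
  if t < a then None else onth (x :: p) (t - a).

Lemma stedges_cat a x p q :
  stedges a x (p ++ q) = stedges a x p ++ stedges (a + size p) (last x p) q.
Proof.
elim: p a x => [|w p IH] a x /=; first by rewrite addn0.
by rewrite IH addSnnS.
Qed.

Lemma position_cons a x w p t :
  position a x (w :: p) t = if t == a then Some x else position a.+1 w p t.
Proof.
rewrite /position ltnS; case: (ltngtP t a) => [||->] //; last by rewrite subnn.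
by move=> lt_at; rewrite -(subnSK lt_at).
Qed.

Lemma position_start a x p : position a x p a = Some x.
Proof. by rewrite /position ltnn subnn. Qed.

Lemma position_last a x p : position a x p (a + size p) = Some (last x p).
Proof.
elim: p a x => [|w p IH] a x; first by rewrite addn0 position_start.
by rewrite position_cons /= addnS gtn_eqF ?ltnS ?leq_addr // -addSn IH.
Qed.

Lemma position_before a x p t : t < a -> position a x p t = None.
Proof. by rewrite /position => ->. Qed.

(** Time stamps increase strictly along a trajectory, so no triple repeats. This identifies the
    loads in [feasible] with multiplicities in lists of edges. *)
Lemma count_stedges a x p t v w :
  count_mem (t, v, w) (stedges a x p) =
    ((position a x p t == Some v) && (position a x p t.+1 == Some w)) :> nat.
Proof.
elim: p a x => [|y p IH] a x /=.
  rewrite /position; case: (ltnP t a) => // le_at; rewrite ltnNge (leqW le_at).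
  by rewrite subSn //= onth0n andbF.
rewrite {}IH !position_cons !xpair_eqE [a == t]eq_sym.
case: (t =P a) => [->|/eqP ne_ta] /=.
  rewrite position_before // gtn_eqF // position_start addn0.
  by rewrite -[Some x == _]/(x == v) -[Some y == _]/(y == w).
rewrite add0n; case: (t.+1 =P a) => // eq_ta.
by rewrite !position_before // -eq_ta // ltnS leqnSn.
Qed.

Lemma count_stedges_le1 a x p e : count_mem e (stedges a x p) <= 1.
Proof. by case: e => [[t v] w]; rewrite count_stedges leq_b1. Qed.

Lemma count_stedges_path (R : rel V) a x p t v w : path R x p ->
  count_mem (t, v, w) (stedges a x p) <= (R v w && (a <= t < a + size p)).
Proof.
elim: p a x => //= y p IH a x /andP[Rxy /(IH a.+1)]; rewrite !xpair_eqE.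
case: (a =P t) => [<-|/eqP ne_at] /=.
  rewrite ltnn andbF leqn0 => /eqP->; rewrite addn0 leqnn -addSnnS leq_addr andbT.
  by case: eqP => // <-; case: eqP => // <-; rewrite Rxy.
by rewrite add0n addSnnS ltn_neqAle ne_at.
Qed.

Lemma position_step a x p t w : a <= t -> position a x p t.+1 = Some w ->
  exists2 v, position a x p t = Some v &
    v \in belast x p /\ forall R : rel V, path R x p -> R v w.
Proof.
elim: p a x => [|y p IH] a x le_at.
  by rewrite /position ltnNge (leqW le_at) /= subSn //= onth0n.
rewrite !position_cons gtn_eqF //; case: eqP => [->|/eqP ne_ta].
  rewrite position_start => -[<-]; exists x => //=; split; first exact: mem_head.
  by move=> R /andP[].
have lt_at : a < t by rewrite ltn_neqAle eq_sym ne_ta.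
case/IH=> // v pv [vp Rv]; exists v => //; split=> [|R /=].
  by rewrite /= inE vp orbT.
by case/andP=> _; apply: Rv.
Qed.

Definition orbit_of (Y : nat -> V) a m := [seq Y t | t <- iota a.+1 m].

Lemma stedges_orbit (Y : nat -> V) a m :
  stedges a (Y a) (orbit_of Y a m) = [seq (t, Y t, Y t.+1) | t <- iota a m].
Proof. by rewrite /orbit_of; elim: m a => //= m IH a; rewrite IH. Qed.

Lemma last_orbit (Y : nat -> V) a m : last (Y a) (orbit_of Y a m) = Y (a + m).
Proof.
rewrite /orbit_of; elim: m a => [|m IH] a /=; first by rewrite addn0.
by rewrite IH addSnnS.
Qed.

Lemma belast_orbit (Y : nat -> V) a m :
  belast (Y a) (orbit_of Y a m) = [seq Y t | t <- iota a m].
Proof. by rewrite /orbit_of; elim: m a => //= m IH a; rewrite IH. Qed.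

Lemma path_orbit (R : rel V) (Y : nat -> V) a m :
  (forall t, a <= t < a + m -> R (Y t) (Y t.+1)) -> path R (Y a) (orbit_of Y a m).
Proof.
rewrite /orbit_of; elim: m a => //= m IH a RY.
rewrite RY ?leqnn -?addSnnS ?leq_addr //=; apply: IH => t /andP[lt_at le_t].
by apply: RY; rewrite (ltnW lt_at) -addSnnS.
Qed.

Lemma count_orbit (Y : nat -> V) a m t v w :
  count_mem (t, v, w) [seq (t, Y t, Y t.+1) | t <- iota a m] =
    [&& a <= t < a + m, Y t == v & Y t.+1 == w] :> nat.
Proof.
elim: m a => [|m IH] a /=; first by rewrite addn0 ltnNge andbN.
rewrite IH !xpair_eqE -addSnnS.
case: (ltngtP a t) => [lt_at|lt_ta|->]; rewrite /= ?add0n //.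
by rewrite addSn ltnS leq_addr /= addn0.
Qed.

End Trajectories.

(** * Exponential edge weights *)

Import Order.TTheory GRing.Theory Num.Theory.

Section Weight.
Variables k P : nat.
Local Open Scope ring_scope.

Definition weight (u m : nat) : rat :=
  ((1 + k%:R / u%:R) ^+ m - 1) / P%:R.

Lemma weight0 u : weight u 0 = 0.
Proof. by rewrite /weight expr0 subrr mul0r. Qed.

Lemma weight_le u m m' : (m <= m')%N -> weight u m <= weight u m'.
Proof.
move=> le_m; apply: ler_wpM2r; first by rewrite invr_ge0 ler0n.
by rewrite lerD2r ler_weXn2l // lerDl divr_ge0 ?ler0n.
Qed.

Lemma weight_ge0 u m : 0 <= weight u m.
Proof. by rewrite -(weight0 u) weight_le. Qed.

Lemma weight_full u : (0 < u)%N -> (k <= u)%N -> (0 < P)%N -> (P.+1 < 2 ^ k)%N ->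
  1 < weight u u.
Proof.
move=> u0 ku P0 Pk; have uP : 0 < u%:R :> rat by rewrite ltr0n.
rewrite /weight ltr_pdivlMr ?ltr0n // mul1r ltrBrDr natr1.
have -> : 1 + k%:R / u%:R = (u + k)%N%:R / u%:R :> rat.
  by rewrite natrD mulrDl divff // gt_eqF.
rewrite expr_div_n ltr_pdivlMr ?exprn_gt0 // -!natrX -natrM ltr_nat.
apply: leq_trans (expn_add_ge ku).
by rewrite ltn_pmul2r // expn_gt0 u0.
Qed.

(* Summed along a route of weight at most 1 and length at most P, the right-hand
   side is at most 2k: the potential grows by at most 2k per accepted request. *)
Lemma weightS u m : (0 < u)%N -> (0 < P)%N ->
  u%:R * (weight u m.+1 - weight u m) = k%:R * (weight u m + P%:R^-1).
Proof.
move=> u0 P0; rewrite /weight exprS; field.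
by rewrite !pnatr_eq0 -!lt0n u0 P0.
Qed.

End Weight.

Section CountSums.
Local Open Scope ring_scope.
Variables (T : eqType) (E es : seq T) (F : T -> rat).
Hypothesis uE : uniq E.

Let sum_delta a : \sum_(e <- E) (a == e)%:R * F e = if a \in E then F a else 0.
Proof.
case: ifPn => aE.
  rewrite (bigD1_seq a) //= eqxx mul1r big1 ?addr0 // => e /negPf ne.
  by rewrite eq_sym ne mul0r.
rewrite big_seq big1 // => e eE; case: eqP => [ae|]; last by rewrite mul0r.
by rewrite ae eE in aE.
Qed.

Lemma sum_count : (forall e, e \notin E -> F e = 0) ->
  \sum_(e <- es) F e = \sum_(e <- E) (count_mem e es)%:R * F e.
Proof.
move=> F0; elim: es => [|a s IH].
  by rewrite big_nil big1 // => e _; rewrite mul0r.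
rewrite big_cons IH /=; under [RHS]eq_bigr => e _ do rewrite natrD mulrDl.
by rewrite big_split /= sum_delta; case: ifPn => // /F0->.
Qed.

(** Entries of [es] outside [E] only add nonnegative terms on the right. *)
Lemma sum_count_le : (forall e, 0 <= F e) ->
  \sum_(e <- E) (count_mem e es)%:R * F e <= \sum_(e <- es) F e.
Proof.
move=> F0; elim: es => [|a s IH].
  by rewrite big_nil big1 // => e _; rewrite mul0r.
rewrite big_cons /=; under eq_bigr => e _ do rewrite natrD mulrDl.
by rewrite big_split lerD //= sum_delta; case: ifP.
Qed.

End CountSums.

Lemma gedge_neq d (l : 'I_d -> nat) v w : gedge l v w -> v != w.
Proof.
case/and3P=> _ _ /existsP[j /eqP->]; apply/eqP => /ffunP/(_ j).
by rewrite ffunE eqxx addn1 => /eqP; rewrite eqn_leq ltnn andbF.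
Qed.

(** * The algorithm *)

Section Algorithm.
Variables (d : nat) (l : 'I_d -> nat) (c B k P : nat).
Implicit Types (r : request d) (s : seq (request d)) (p : seq (node d)).
Local Notation edge := (nat * node d * node d)%type.
Implicit Types (h : seq edge) (e : edge).

Definition hop : rel (node d) := fun v w => (v == w) || gedge l v w.

(** A space-time edge with equal ends occupies a buffer slot, any other one a link. *)
Definition cap e := if e.1.2 == e.2 then B else c.

Definition redges r p : seq edge := stedges (arr r) (src r) p.

Definition edge_weight h e : rat := weight k P (cap e) (count_mem e h).

Definition cost h p_edges : rat := (\sum_(e <- p_edges) edge_weight h e)%R.

(** The destination may occur only at the end, since the model removes a packet that reaches it. *)
Definition valid_route r p : bool :=
  [&& path hop (src r) p, last (src r) p == dst r,
      dst r \notin belast (src r) p, size p <= P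
    & if ddl r is Some dl then arr r + size p <= dl else true].

Definition admissible h r p :=
  valid_route r p && (cost h (redges r p) <= 1)%R.

(* [::] encodes both rejection and immediate delivery (source = destination). *)
Definition select h r : seq (node d) :=
  match excluded_middle_informative (exists p, admissible h r p) with
  | left ex => xchoose ex
  | right _ => [::]
  end.

(** The multiplicity of an edge in this list is its current load. *)
Definition history s : seq edge :=
  foldl (fun h r => h ++ redges r (select h r)) [::] s.

Definition route s i : seq (node d) := select (history (take i s)) (req_at s i).

Definition routing s : execution d := fun i t =>
  position (arr (req_at s i)) (src (req_at s i)) (route s i) t.

Definition accepted s i : bool := route s i != [::].

Lemma size_redges r p : size (redges r p) = size p.
Proof. by rewrite /redges; elim: p (arr r) (src r) => //= w p IH a x; rewrite IH. Qed.

Lemma selectP h r : select h r != [::] -> admissible h r (select h r).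
Proof.
by rewrite /select; case: excluded_middle_informative => // ex _; apply: xchooseP.
Qed.

Lemma select_complete h r p : select h r = [::] -> src r != dst r ->
  valid_route r p -> (1 < cost h (redges r p))%R.
Proof.
rewrite /select; case: excluded_middle_informative => [ex|nex _ _ vp].
  move=> eq0; have := xchooseP ex; rewrite eq0.
  by case/andP=> /and3P[_ /= /eqP-> _ _]; rewrite eqxx.
by rewrite ltNge; apply/negP => cp; apply: nex; exists p; apply/andP.
Qed.

Lemma historyS s i : i < size s ->
  history (take i.+1 s) = history (take i s) ++ redges (req_at s i) (route s i).
Proof. by move=> lt_is; rewrite (take_nth (req0 d)) // /history foldl_rcons. Qed.

Lemma count_history s m e : m <= size s ->
  count_mem e (history (take m s)) =
    \sum_(i < m) count_mem e (redges (req_at s i) (route s i)).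
Proof.
elim: m => [|m IH] lt_ms; first by rewrite take0 big_ord0.
by rewrite historyS // count_cat IH ?(ltnW lt_ms) // big_ord_recr.
Qed.

Lemma count_history_le s m e :
  count_mem e (history (take m s)) <= count_mem e (history s).
Proof.
have [lt_ms|] := ltnP m (size s); last by move/take_oversize->.
rewrite -{2}(take_size s) !count_history //; last exact: ltnW.
rewrite (big_ord_widen _ (fun i => count_mem e (redges (req_at s i) (route s i)))
           (ltnW lt_ms)).
by rewrite big_mkcond leq_sum // => i _; case: ifP.
Qed.

Lemma edge_weight_ge0 h e : (0 <= edge_weight h e)%R.
Proof. exact: weight_ge0. Qed.

(** Inputs are sorted by time, so the requests up to time [t] form a prefix, and the route of
    request [i] depends only on the first [i + 1] requests. *)
Lemma online_routing : online l routing.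
Proof.
move=> s s' t /andP[_ ss] /andP[_ ss'] eqf i lt_if u _.
have pref (z : seq (request d)) : sorted (fun r1 r2 => arr r1 <= arr r2) z ->
    [seq r <- z | arr r <= t] = take (size [seq r <- z | arr r <= t]) z.
  elim: z => //= r z IH; rewrite path_sortedE; last by move=> ? ? ? /leq_trans; apply.
  case/andP=> ge_r /IH eqz; case: ifP => [_|gt_t] /=; first by rewrite -eqz.
  suff -> : [seq r <- z | arr r <= t] = [::] by [].
  apply: size0nil; apply/eqP; rewrite size_filter -leqn0 leqNgt -has_count.
  rewrite -all_predC; apply: sub_all ge_r => r' le_r /=; rewrite -ltnNge.
  by apply: leq_trans le_r; rewrite ltnNge gt_t.
have local z m : i < m -> routing (take m z) i = routing z i.
  move=> lt_im; rewrite /routing /route /req_at take_takel ?nth_take //.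
  exact: ltnW.
rewrite -(local s _ lt_if) -pref // eqf.
by rewrite [in LHS]pref // local // -eqf.
Qed.

Lemma feasible_routing s :
  (forall e, count_mem e (history s) <= cap e) -> feasible l c B s (routing s).
Proof.
move=> load; have cnt t v w : \sum_(i < size s)
    ((routing s i t == Some v) && (routing s i t.+1 == Some w)) <= cap (t, v, w).
  apply: leq_trans (load (t, v, w)).
  by rewrite -[in leqRHS](take_size s) count_history //; apply/eq_leq/eq_bigr => i _; rewrite count_stedges.
split=> [i lt_is r|]; last split=> [t v w /gedge_neq/negPf ne_vw|t v].
- split=> [t||t w le_at]; [exact: position_before | exact: position_start|].
  case/(position_step le_at)=> v pv [vp hv]; exists v; split=> //.
    have /selectP/andP[/and5P[_ _ ndst _ _] _] : route s i != [::].
      by apply: contraTneq vp => ->.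
    by apply: contraNneq ndst => <-.
  have /selectP/andP[/and5P[/hv + _ _ _ _] _] : route s i != [::].
    by apply: contraTneq vp => ->.
  by case/orP=> [/eqP->|]; [left | right].
- by have := cnt t v w; rewrite /cap /= ne_vw.
- by have := cnt t v v; rewrite /cap /= eqxx.
Qed.

Lemma accepted_delivered s i : accepted s i ->
  delivered_by_deadline s (routing s) i.
Proof.
case/selectP/andP=> /and5P[_ /eqP last_p _ _ dl_p] _.
exists (arr (req_at s i) + size (route s i)).
split; first by rewrite /routing position_last last_p.
by move: dl_p; rewrite /route; case: ddl.
Qed.

Lemma rejected_routing s i : ~~ accepted s i -> src (req_at s i) != dst (req_at s i) ->
  rejected_on_arrival s (routing s) i.
Proof.
rewrite negbK => /eqP eq0 ne; split=> //; rewrite /routing eq0 /position ltnNge leqnSn.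
by rewrite subSn //= onth0n.
Qed.

Lemma no_preemption_routing s : no_preemption s (routing s).
Proof.
move=> i _; have [/accepted_delivered[t [dt _]]|rej] := boolP (accepted s i).
  by right; exists t.
have [eq|ne] := eqVneq (src (req_at s i)) (dst (req_at s i)).
  by right; exists (arr (req_at s i)); rewrite /routing position_start eq.
by left; apply: rejected_routing.
Qed.

(** * Capacity and potential bounds for the algorithm *)

Hypotheses (k0 : 0 < k) (kB : k <= B) (kc : k <= c) (P0 : 0 < P).
Hypothesis Pk : P.+1 < 2 ^ k.

Lemma cap_ge e : k <= cap e.
Proof. by rewrite /cap; case: ifP. Qed.

Lemma cap_gt0 e : 0 < cap e.
Proof. exact: leq_trans k0 (cap_ge e). Qed.

(** A route uses an edge at most once, so the load could pass the capacity only by a route through a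
    saturated edge. *)
Lemma load_le s m e : m <= size s -> count_mem e (history (take m s)) <= cap e.
Proof.
elim: m => [|m IH] lt_ms; first by rewrite take0.
rewrite historyS // count_cat.
have := IH (ltnW lt_ms); rewrite leq_eqVlt => /orP[/eqP full|lt_cap]; last first.
  by apply: leq_trans lt_cap; rewrite -addn1 leq_add2l count_stedges_le1.
(* A saturated edge alone already weighs more than 1, which an admissible route cannot afford. *)
suff -> : count_mem e (redges (req_at s m) (route s m)) = 0 by rewrite addn0 full.
apply/eqP; rewrite -leqn0 leqNgt -has_count has_pred1; apply/negP => e_in.
have /selectP/andP[_] : route s m != [::] by apply: contraTneq e_in => ->.
rewrite leNgt => /negP; apply; rewrite /cost (big_rem _ e_in) /=.
apply: (@lt_le_trans _ _ (edge_weight (history (take m s)) e)).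
  by rewrite /edge_weight full weight_full ?cap_gt0 ?cap_ge.
by rewrite lerDl sumr_ge0 // => e' _; apply: edge_weight_ge0.
Qed.

Local Open Scope ring_scope.

Lemma potential_le s (E : seq edge) m : uniq E -> (m <= size s)%N ->
  \sum_(e <- E) (cap e)%:R * edge_weight (history (take m s)) e
    <= 2 * k%:R * (\sum_(i < m) accepted s i)%N%:R.
Proof.
move=> uE; elim: m => [|m IH] lt_ms.
  rewrite take0 big_ord0 mulr0 big1 // => e _.
  by rewrite /edge_weight weight0 mulr0.
rewrite historyS // big_ord_recr /= natrD mulrDr.
have {IH} := IH (ltnW lt_ms).
set h := history _; set es := redges _ _ => IH.
(* The multiplicity of [e] in the new route is 0 or 1, so [weightS] gives the exact increment. *)
have split_e e : (cap e)%:R * edge_weight (h ++ es) e =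
    (cap e)%:R * edge_weight h e +
    (count_mem e es)%:R * (k%:R * (edge_weight h e + P%:R^-1)).
  rewrite {1}/edge_weight count_cat -/(edge_weight h e).
  have := count_stedges_le1 (arr (req_at s m)) (src (req_at s m)) (route s m) e.
  rewrite -/(redges _ _) -/es; case: (count_mem e es) => [_|[_|//]].
    by rewrite addn0 mul0r addr0.
  by rewrite addn1 mul1r /edge_weight -weightS ?cap_gt0 // mulrBr addrC subrK.
under eq_bigr => e _ do rewrite split_e.
rewrite big_split lerD //=.
apply: (le_trans (sum_count_le _ uE _)) => [e|].
  by apply: mulr_ge0; rewrite ?ler0n // addr_ge0 ?edge_weight_ge0 // invr_ge0 ler0n.
rewrite -mulr_sumr big_split /= big_const_seq iter_addr addr0.
have [acc|rej] := boolP (accepted s m); last first.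
  move: rej; rewrite negbK => /eqP rej.
  by rewrite /es rej /= big_nil mulr0n addr0 !mulr0.
have /andP[/and5P[_ _ _ szp _] cost_le] := selectP acc.
(* One [k] comes from the cost being at most 1, the other from at most [P] edges contributing [1/P]
   each. *)
rewrite mulr1 mulrC ler_wpM2r ?ler0n // lerD //.
rewrite -(mulr_natr P%:R^-1) mulrC ler_pdivrMr ?ltr0n // mul1r ler_nat.
by rewrite count_predT size_redges.
Qed.

(* Weak duality: the q i T form a fractional packing of J that violates the
   capacities by a factor 2, and each of them is priced above 1 by the final
   weights. *)
Lemma rejected_le s (J : pred nat) W (q : nat -> nat -> seq (node d)) :
  (0 < W)%N ->
  (forall i, (i < size s)%N -> J i ->
     [/\ ~~ accepted s i, src (req_at s i) != dst (req_at s i) &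
         forall T, (T < W)%N -> valid_route (req_at s i) (q i T)]) ->
  (forall e, \sum_(i < size s | J i) \sum_(T < W)
      count_mem e (redges (req_at s i) (q i T)) <= 2 * W * cap e)%N ->
  (\sum_(i < size s) J i <= 4 * k * \sum_(i < size s) accepted s i)%N.
Proof.
move=> W0 Jq load; rewrite -(ler_nat rat) -(ler_pM2l (_ : 0 < W%:R :> rat)) ?ltr0n //.
(* Unloaded edges have weight 0, so sums over all edges reduce to [E]. *)
set h := history s; set E := undup h.
have w0 e : e \notin E -> edge_weight h e = 0.
  by rewrite mem_undup => /count_memPn eh; rewrite /edge_weight eh weight0.
apply: (@le_trans _ _ (\sum_(i < size s | J i) \sum_(T < W)
    cost h (redges (req_at s i) (q i T)))).
  rewrite natr_sum mulr_sumr [leRHS]big_mkcond; apply: ler_sum => i _ /=.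
  case: ifP => [Ji|_]; last by rewrite mulr0.
  have [rej ne vq] := Jq i (ltn_ord i) Ji.
  rewrite mulr1 -[W in leLHS]card_ord -sum1_card natr_sum; apply: ler_sum => T _.
  move: rej; rewrite negbK => /eqP rej.
  (* The route cost more than 1 at the time of rejection, and weights only grow afterwards. *)
  apply/ltW/(lt_le_trans (select_complete rej ne (vq T (ltn_ord T)))).
  by apply: ler_sum => e _; apply/weight_le/count_history_le.
have -> : \sum_(i < size s | J i) \sum_(T < W) cost h (redges (req_at s i) (q i T)) =
    \sum_(e <- E) (\sum_(i < size s | J i) \sum_(T < W)
      count_mem e (redges (req_at s i) (q i T)))%N%:R * edge_weight h e.
  under [RHS]eq_bigr => e _ do rewrite natr_sum mulr_suml.
  rewrite [RHS]exchange_big; apply: eq_bigr => i _ /=.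
  under [RHS]eq_bigr => e _ do rewrite natr_sum mulr_suml.
  rewrite [RHS]exchange_big; apply: eq_bigr => T _ /=.
  by rewrite /cost (sum_count _ (undup_uniq h)).
apply: (@le_trans _ _ (\sum_(e <- E) (2 * W)%N%:R * ((cap e)%:R * edge_weight h e))).
  apply: ler_sum => e _; rewrite mulrA ler_wpM2r ?edge_weight_ge0 //.
  by rewrite -natrM ler_nat.
rewrite -mulr_sumr.
have := potential_le (undup_uniq h) (leqnn (size s)); rewrite take_size -/h -/E.
move=> /(ler_wpM2l (ler0n rat (2 * W)))/le_trans; apply.
by rewrite !natrM le_eqVlt; apply/orP; left; apply/eqP; ring.
Qed.

End Algorithm.

(** * Short fractional routes for an arbitrary schedule *)

Lemma pboolP (Q : Prop) : reflect Q (pbool Q).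
Proof. by rewrite /pbool; case: excluded_middle_informative => h; constructor. Qed.

(** * Path lengths and the number of nodes in the grid *)

Section Grid.
Variables (d : nat) (l : 'I_d -> nat).
Implicit Types u v w : node d.

Definition level v := \sum_j v j.

(** The coordinate sum is a grading: all paths between two given nodes have the same length, so
    every path is shortest and the diameter bounds it. *)
Lemma gedge_level v w : gedge l v w -> level w = (level v).+1.
Proof.
case/and3P=> _ _ /existsP[j /eqP->]; rewrite /level.
under eq_bigr => i _ do rewrite ffunE.
rewrite big_split /= [X in _ + X](bigD1 j) //= eqxx [X in _ + (_ + X)]big1 ?addn1 // => i /negPf ne.
by rewrite ne.
Qed.

Lemma gpath_level m u v : gpath l m u v -> level v = level u + m.
Proof.
elim: m u => /= [u ->|m IH u [w [/gedge_level e_uw /IH->]]]; first by rewrite addn0.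
by rewrite e_uw addSnnS.
Qed.

Lemma gpath_diam D m u v : is_diam l D -> in_grid l u -> in_grid l v ->
  gpath l m u v -> m <= D.
Proof.
move=> [_ maxD] gu gv uv; apply: (maxD u v) => //; split=> // m' /gpath_level eq_m'.
by move: (gpath_level uv); rewrite eq_m' => /addnI->.
Qed.

Lemma gpath_seq m u v : gpath l m u v ->
  exists p, [/\ path (gedge l) u p, last u p = v, size p = m & v \notin belast u p].
Proof.
elim: m u => /= [u ->|m IH u [w [uw wv]]]; first by exists [::].
have [p [pp lp sp np]] := IH _ wv.
exists (w :: p); split=> //=; rewrite ?uw ?sp //.
rewrite inE negb_or np andbT; apply: contraTneq (leqnn (level u)) => eq_vu.
by rewrite -{1}eq_vu (gpath_level wv) (gedge_level uw) addSn -ltnNge ltnS leq_addr.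
Qed.

Lemma diam_le D : (forall j, 0 < l j) -> is_diam l D -> D <= d * grid_size l.
Proof.
move=> l0 [[u [v [_ /forallP gv [/gpath_level eq_uv _]]]] _].
apply: (@leq_trans (level v)); first by rewrite eq_uv leq_addl.
have -> : d * grid_size l = \sum_(j < d) grid_size l by rewrite sum_nat_const card_ord.
apply: leq_sum => j _; apply: leq_trans (ltnW (gv j)) _.
by rewrite /grid_size (bigD1 j) //= leq_pmulr // prodn_gt0.
Qed.

Lemma diam_gt0 D (r : request d) : is_diam l D -> valid_request l r ->
  src r != dst r -> 0 < D.
Proof.
move=> hD /and3P[gs gd /forallP le_sd] ne.
have [j lt_j] : exists j, src r j < dst r j.
  apply/existsP; apply: contraNT ne => /existsPn ge_sd; apply/eqP/ffunP => j.
  by apply/eqP; rewrite eqn_leq le_sd leqNgt ge_sd.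
have gw : in_grid l (unit_step (src r) j).
  apply/forallP => i; rewrite ffunE; apply: leq_ltn_trans (forallP gd i).
  by case: eqP => [->|_]; rewrite ?addn1 ?addn0.
apply: (gpath_diam hD gs gw (m := 1)); exists (unit_step (src r) j); split=> //.
by rewrite /gedge gs gw; apply/existsP; exists j.
Qed.

(** The type [node d] is infinite; sums over the nodes of the grid run over this finite type. *)
Definition grid_point := {dffun forall j : 'I_d, 'I_(l j)}.

Definition node_of (g : grid_point) : node d := [ffun j => g j : nat].

Lemma card_grid_point : #|{: grid_point}| = grid_size l.
Proof.
rewrite card_dep_ffun /grid_size -big_enum /= /image_mem.
elim: (enum 'I_d) => [|j js IH] /=; first by rewrite big_nil.
by rewrite big_cons IH card_ord.
Qed.

Lemma node_ofP v : in_grid l v -> exists g, node_of g = v.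
Proof.
move=> /forallP gv; exists [ffun j => Ordinal (gv j)].
by apply/ffunP => j; rewrite !ffunE.
Qed.

End Grid.

Lemma sum_shift_le W a x : \sum_(T < W) (x == a + T) <= (a <= x < a + W).
Proof.
elim: W => [|W IH]; first by rewrite big_ord0.
rewrite big_ord_recr /=; apply: leq_trans (leq_add IH (leqnn _)) _.
rewrite addnS ltnS; case: (ltngtP x (a + W)) => [_|_|->].
- by rewrite addn0.
- by rewrite andbF.
- by rewrite andbF leq_addr.
Qed.

(** A contributing [T] satisfies [a + T = t - i] for some [i < D], and each value [t - i] is hit by
    at most one [T]. *)
Lemma sum_window_le W D a t (f : pred nat) :
  \sum_(T < W) (f (a + T) && (a + T <= t < a + T + D)) <= \sum_(i < D) f (t - i).
Proof.
apply: (@leq_trans (\sum_(i < D) \sum_(T < W) f (t - i) * (t - i == a + T))).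
  rewrite exchange_big; apply: leq_sum => T _ /=.
  case fT: (f _) => //=; case: andP => //= -[le_t lt_t].
  have lt_i : t - (a + T) < D by rewrite ltn_subLR.
  by rewrite (bigD1 (Ordinal lt_i)) //= subKn // fT eqxx.
apply: leq_sum => i _; rewrite -big_distrr /=.
apply: leq_trans (leq_mul (leqnn _) (sum_shift_le W a (t - i))) _.
by case: (f _); rewrite ?mul0n // mul1n leq_b1.
Qed.

(** * Loads of an arbitrary feasible schedule and its short reroutings *)

Section Offline.
Variables (d : nat) (l : 'I_d -> nat) (c B : nat) (s : seq (request d)).
Variable X : execution d.
Hypotheses (vs : valid_input l s) (fX : feasible l c B s X).

Let valid_req i : i < size s -> valid_request l (req_at s i).
Proof. by case/andP: vs => /(all_nthP (req0 d)) h _ /h. Qed.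

Let step i t w : i < size s -> arr (req_at s i) <= t -> X i t.+1 = Some w ->
  exists v, [/\ X i t = Some v, v != dst (req_at s i) & hop l v w].
Proof.
move=> lt_i le_t Xw; have [_ _ /(_ t w le_t Xw)[v [Xv ne vw]]] := fX.1 i lt_i.
by exists v; split=> //; apply/orP; case: vw => [->|]; [left | right].
Qed.

Let arrived i t v : i < size s -> X i t = Some v -> arr (req_at s i) <= t.
Proof.
move=> lt_i Xv; have [before _ _] := fX.1 i lt_i.
by rewrite leqNgt; apply/negP => /before; rewrite Xv.
Qed.

Lemma in_grid_execution i t v : i < size s -> X i t = Some v -> in_grid l v.
Proof.
move=> lt_i; have [before start _] := fX.1 i lt_i.
elim: t v => [|t IH] v Xv; have := arrived lt_i Xv; rewrite leq_eqVlt => /orP[/eqP eq_t|].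
- by move: Xv; rewrite -eq_t start => -[<-]; case/and3P: (valid_req lt_i).
- by [].
- by move: Xv; rewrite -eq_t start => -[<-]; case/and3P: (valid_req lt_i).
rewrite ltnS => /(step lt_i)/(_ Xv)[u [/IH gu _ /orP[/eqP<-//|]]].
by case/and3P.
Qed.

(** A deleted or delivered packet never reappears, so a later position can be traced back step by
    step. *)
Lemma execution_before i t t' w : i < size s -> arr (req_at s i) <= t -> t <= t' ->
  X i t' = Some w ->
  exists v, [/\ X i t = Some v, t < t' -> v != dst (req_at s i) & exists m, gpath l m v w].
Proof.
move=> lt_i le_t; elim: t' w => [|t' IH] w.
  rewrite leqn0 => /eqP-> Xw; exists w; split=> //; by exists 0.
rewrite leq_eqVlt => /orP[/eqP-> Xw|].
  by exists w; split; rewrite ?ltnn //; exists 0.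
rewrite ltnS => le_t' /(step lt_i (leq_trans le_t le_t'))[u [Xu ne uw]].
have [v [Xv nev [m vu]]] := IH u le_t' Xu; exists v; split=> //.
  move=> _; move: le_t'; rewrite leq_eqVlt => /orP[/eqP eq_t|/nev//].
  by move: Xv; rewrite eq_t Xu => -[<-].
case/orP: uw => [/eqP<-|uw]; first by exists m.
exists m.+1; elim: m v vu {Xv nev} => /= [v ->|m IHm v [v' [vv' v'u]]].
  by exists w.
by exists v'; split=> //; apply: IHm.
Qed.

Lemma execution_load e :
  \sum_(i < size s) ((X i e.1.1 == Some e.1.2) && (X i e.1.1.+1 == Some e.2)) <= cap c B e.
Proof.
case: e => [[t v] w] /=; rewrite /cap /=; have [_ [lc lB]] := fX.
case: eqP => [<-|/eqP ne]; first exact: lB.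
have [/lc//|nvw] := boolP (gedge l v w).
rewrite big1 // => i _; case: andP => // -[/eqP Xv /eqP Xw].
have [u [Xu _]] := step (ltn_ord i) (arrived (ltn_ord i) Xv) Xw.
by move: Xu; rewrite Xv => -[<-]; rewrite /hop (negPf ne) (negPf nvw).
Qed.

(** Such a packet occupies a buffer slot or a link during step [t]. *)
Definition active i t : bool := X i t && X i t.+1.

(** Each active packet is charged to its node, which offers [B] buffer slots and at most [d]
    outgoing links of capacity [c]. *)
Lemma active_le t : \sum_(i < size s) active i t <= grid_size l * (B + d * c).
Proof.
pose stay i (g : grid_point l) :=
  (X i t == Some (node_of g)) && (X i t.+1 == Some (node_of g)).
pose go i (g : grid_point l) j := (X i t == Some (node_of g)) &&
  (X i t.+1 == Some (unit_step (node_of g) j)).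
pose ok (g : grid_point l) j := gedge l (node_of g) (unit_step (node_of g) j).
apply: (@leq_trans (\sum_(i < size s) \sum_g (stay i g + \sum_(j | ok g j) go i g j))).
  apply: leq_sum => i _; rewrite /active.
  case Xv: (X i t) => [v|//]; case Xw: (X i t.+1) => [w|//] /=.
  have [u [Xu _]] := step (ltn_ord i) (arrived (ltn_ord i) Xv) Xw.
  move: Xu; rewrite Xv => -[<-] {u} vw.
  have [g gv] := node_ofP (in_grid_execution (ltn_ord i) Xv).
  rewrite (bigD1 g) //= addn_gt0; apply/orP; left.
  case/orP: vw => [/eqP eq_vw|vw]; rewrite addn_gt0.
    by rewrite /stay Xv Xw gv -eq_vw !eqxx.
  have /and3P[_ _ /existsP[j /eqP eq_w]] := vw.
  by rewrite orbC (bigD1 j) /= ?addn_gt0 /go /ok gv -?eq_w // Xv Xw !eqxx.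
rewrite exchange_big -card_grid_point -sum_nat_const leq_sum // => g _.
rewrite big_split leq_add //=; first exact: fX.2.2.
rewrite exchange_big /= -[d in leqRHS]card_ord -sum_nat_const big_mkcond leq_sum //= => j _.
by case: ifP => // ok_gj; apply: fX.2.1 ok_gj.
Qed.

(* A packet that X delivers late is replaced by W copies; copy T follows it for T
   steps and then heads straight to its destination. *)
Lemma reroute D W i t' T : is_diam l D -> i < size s -> T < W ->
  X i t' = Some (dst (req_at s i)) ->
  (if ddl (req_at s i) is Some dl then t' <= dl else true) ->
  exists q, valid_route l (W + D) (req_at s i) q /\
    forall e, count_mem e (redges (req_at s i) q) <=
      ((X i e.1.1 == Some e.1.2) && (X i e.1.1.+1 == Some e.2)) +
      [&& e.1.2 != e.2, active i (arr (req_at s i) + T) &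
          arr (req_at s i) + T <= e.1.1 < arr (req_at s i) + T + D].
Proof.
move=> hD lt_i lt_T; set r := req_at s i => Xd dl.
have le_t' := arrived lt_i Xd; have [_ start _] := fX.1 i lt_i.
(* The default is harmless: [X] is defined from the input to the delivery of the packet, the only
   times at which [Y] is used. *)
pose Y t := odflt (src r) (X i t).
have XY t : arr r <= t <= t' -> X i t = Some (Y t).
  by case/andP=> le_t /(execution_before lt_i le_t)/(_ Xd)[v [Xv _ _]]; rewrite /Y Xv.
have Ya : Y (arr r) = src r by rewrite /Y start.
have Yne t : arr r <= t < t' -> Y t != dst r.
  case/andP=> le_t lt_t; have [v [Xv ne _]] := execution_before lt_i le_t (ltnW lt_t) Xd.
  by rewrite /Y Xv ne.
have Yhop t : arr r <= t < t' -> hop l (Y t) (Y t.+1).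
  case/andP=> le_t lt_t.
  have [v [Xv _ vw]] := step lt_i le_t (XY t.+1 (introT andP (conj (leqW le_t) lt_t))).
  by rewrite {1}/Y Xv.
have Ycount m t v w : arr r + m <= t' ->
    count_mem (t, v, w) [seq (t, Y t, Y t.+1) | t <- iota (arr r) m] <=
    ((X i t == Some v) && (X i t.+1 == Some w)).
  move=> le_m; rewrite count_orbit; case: and3P => // -[/andP[le_t lt_t] /eqP<- /eqP<-].
  have lt_t' := leq_trans lt_t le_m.
  by rewrite (XY t) ?(XY t.+1) ?eqxx ?(leqW le_t) ?le_t ?(ltnW lt_t').
(* A delivery within [W + D] steps is copied unchanged for every [T]. *)
have [short|long] := leqP t' (arr r + (W + D)).
  exists (orbit_of Y (arr r) (t' - arr r)); split.
    apply/and5P; rewrite -Ya; split.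
    - by apply: path_orbit => t; rewrite subnKC //; apply: Yhop.
    - by rewrite last_orbit subnKC // /Y Xd.
    - rewrite belast_orbit; apply/mapP => -[t].
      by rewrite mem_iota subnKC // => /Yne/eqP ne /esym.
    - by rewrite size_map size_iota leq_subLR.
    - by rewrite size_map size_iota subnKC.
  move=> [[t v] w]; rewrite /redges -Ya stedges_orbit.
  by apply: leq_trans (Ycount _ _ _ _ _) (leq_addr _ _); rewrite subnKC.
(* The copy leaves [X] strictly before delivery, so the packet is active at the splitting time. *)
have lt_Tt' : arr r + T < t'.
  by apply: leq_ltn_trans long; rewrite leq_add2l (leq_trans (ltnW lt_T)) ?leq_addr.
have [v [Xv _ [m vd]]] := execution_before lt_i (leq_addr _ _) (ltnW lt_Tt') Xd.
have Yv : Y (arr r + T) = v by rewrite /Y Xv.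
have le_mD : m <= D.
  exact: gpath_diam hD (in_grid_execution lt_i Xv) (in_grid_execution lt_i Xd) vd.
have [p [pp lp sp np]] := gpath_seq vd.
exists (orbit_of Y (arr r) T ++ p); split.
  have le_sz : size (orbit_of Y (arr r) T ++ p) <= W + D.
    by rewrite size_cat size_map size_iota sp leq_add // ltnW.
  apply/and5P; rewrite -Ya; split=> //.
  - rewrite cat_path last_orbit Yv; apply/andP; split.
      apply: path_orbit => t /andP[le_t lt_t]; apply: Yhop.
      by rewrite le_t (ltn_trans lt_t).
    by apply: sub_path pp => x y xy; rewrite /hop xy orbT.
  - by rewrite last_cat last_orbit Yv lp.
  - rewrite belast_cat mem_cat negb_or last_orbit Yv np andbT belast_orbit.
    apply/mapP => -[t]; rewrite mem_iota => /andP[le_t lt_t].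
    by have /eqP ne := Yne t (introT andP (conj le_t (ltn_trans lt_t lt_Tt'))) => /esym.
  (* The copy needs at most [W + D] steps, fewer than [X] does, and [X] meets the deadline. *)
  - case: ddl dl => // dl /(leq_trans _); apply; apply: leq_trans (ltnW long).
    by rewrite leq_add2l.
move=> [[t x] y]; rewrite /redges -Ya stedges_cat count_cat stedges_orbit last_orbit Yv.
rewrite size_map size_iota leq_add ?Ycount ?(ltnW lt_Tt') //=.
(* The direct part never waits and lasts at most [D] steps, which accounts for the second summand of
   the bound. *)
apply: leq_trans (count_stedges_path _ _ _ _ pp) _.
have -> : active i (arr r + T).
  rewrite /active Xv XY // lt_Tt' andbT leqW // leq_addr //.
case: (boolP (gedge l x y)) => //= /gedge_neq->/=.
case: andP => // -[-> lt_t] /=.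
by rewrite (leq_trans lt_t) // leq_add2l sp.
Qed.

End Offline.

(** * Competitive ratio *)

Section Competition.
Variables (d : nat) (l : 'I_d -> nat) (c B k P : nat) (s : seq (request d)).

Let ALG := routing l c B k P s.

Lemma accepted_le_throughput :
  \sum_(i < size s) accepted l c B k P s i <= throughput s ALG.
Proof.
apply: leq_sum => i _; case acc: (accepted _ _ _ _ _ _ _) => //.
by case: pboolP => // -[]; apply: accepted_delivered.
Qed.

Definition missed (X : execution d) (i : nat) : bool :=
  pbool (delivered_by_deadline s X i) && ~~ pbool (delivered_by_deadline s ALG i).

Lemma throughput_le X :
  throughput s X <= throughput s ALG + \sum_(i < size s) missed X i.
Proof.
rewrite -big_split leq_sum //= => i _; rewrite /missed.
by case: pbool; case: pbool.
Qed.

Lemma missedP X i : feasible l c B s X -> i < size s -> missed X i ->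
  [/\ ~~ accepted l c B k P s i, src (req_at s i) != dst (req_at s i) &
      delivered_by_deadline s X i].
Proof.
move=> fX lt_i /andP[/pboolP dX /pboolP nA]; split=> //.
  by apply/negP => /accepted_delivered.
apply/negP => /eqP eq_sd; apply: nA; have [t [Xt dl]] := dX.
have [before start _] := fX.1 i lt_i.
exists (arr (req_at s i)); rewrite /ALG /routing position_start eq_sd; split=> //.
(* A packet whose source is its destination leaves at once in [X] too, so its input time meets the
   deadline. *)
suff -> : arr (req_at s i) = t by [].
apply/eqP; rewrite eqn_leq; apply/andP; split; rewrite leqNgt; apply/negP => lt_t.
  by rewrite before in Xt.
have [v [Xv ne _]] := execution_before fX lt_i (leqnn _) (ltnW lt_t) Xt.
by move: Xv (ne lt_t); rewrite start eq_sd => -[->]; rewrite eqxx.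
Qed.

End Competition.

Section Competitive.
Variables (d : nat) (l : 'I_d -> nat) (c B k W D : nat) (s : seq (request d)).
Hypotheses (vs : valid_input l s) (hD : is_diam l D).
Hypotheses (k0 : 0 < k) (kB : k <= B) (kc : k <= c) (W0 : 0 < W).
Hypothesis Wc : grid_size l * (B + d * c) * D <= W * c.

(** The missed packets account for the factor [4 * k], and the packets that the algorithm delivers
    itself for the extra 1. *)
Lemma routing_competitive X : feasible l c B s X ->
  throughput s X <= (4 * k + 1) * throughput s (routing l c B k (W + D) s).
Proof.
move=> fX; set ALG := routing _ _ _ _ _ _.
have P0 : 0 < W + D by rewrite addn_gt0 W0.
apply: leq_trans (throughput_le l c B k (W + D) s X) _.
rewrite addnC mulnDl mul1n leq_add2r.
apply: leq_trans (_ : _ <= 4 * k * \sum_(i < size s) accepted l c B k (W + D) s i) _; last first.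
  by rewrite leq_mul2l accepted_le_throughput orbT.
pose J i := missed l c B k (W + D) s X i.
have /fin_all_exists[q qP] (x : 'I_(size s) * 'I_W) : exists q, J x.1 ->
    valid_route l (W + D) (req_at s x.1) q /\
    forall e, count_mem e (redges (req_at s x.1) q) <=
      ((X x.1 e.1.1 == Some e.1.2) && (X x.1 e.1.1.+1 == Some e.2)) +
      [&& e.1.2 != e.2, active X x.1 (arr (req_at s x.1) + x.2) &
          arr (req_at s x.1) + x.2 <= e.1.1 < arr (req_at s x.1) + x.2 + D].
  have [Jx|] := boolP (J x.1); last by exists [::].
  have [_ _ [t [Xt dl]]] := missedP fX (ltn_ord x.1) Jx.
  have {}dl : is_true (if ddl (req_at s x.1) is Some dl then t <= dl else true).
    by case: ddl dl.
  have [q hq] := reroute vs fX hD (ltn_ord x.1) (ltn_ord x.2) Xt dl.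
  by exists q.
(* The chosen routes are extended from ordinals to all naturals, with the empty route as default. *)
pose q' i T := if insub i is Some i' then if insub T is Some T' then q (i', T') else [::]
               else [::].
have q'E (i : 'I_(size s)) (T : 'I_W) : q' i T = q (i, T) by rewrite /q' !valK.
apply: (rejected_le k0 kB kc P0 (J := J) (q := q') W0) => [i lt_i Ji|e].
  have [rej ne _] := missedP fX lt_i Ji; split=> // T lt_T.
  rewrite (q'E (Ordinal lt_i) (Ordinal lt_T)).
  by have [] := qP (Ordinal lt_i, Ordinal lt_T) Ji.
apply: (@leq_trans (\sum_(i < size s) \sum_(T < W)
   (((X i e.1.1 == Some e.1.2) && (X i e.1.1.+1 == Some e.2)) +
      [&& e.1.2 != e.2, active X i (arr (req_at s i) + T) &
          arr (req_at s i) + T <= e.1.1 < arr (req_at s i) + T + D]))).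
  rewrite big_mkcond leq_sum // => i _; case: ifP => // Ji.
  by apply: leq_sum => T _; rewrite q'E; have [_ ->] := qP (i, T) Ji.
under eq_bigr => i _ do rewrite big_split /= sum_nat_const card_ord.
(* Each half of the load is at most [W * cap e]: the [W] copies following [X] give the first half,
   the direct portions the second. *)
rewrite big_split -mulnA mul2n -addnn leq_add //=.
  by rewrite -big_distrr leq_mul2l (execution_load fX) orbT.
case: eqP => [_|ne] /=.
  by rewrite big1 // => i _; rewrite big1.
rewrite /cap; move/eqP/negPf: ne => ->.
(* The direct portions on a link come from copies that split off at one of [D] times, and at each
   time at most [n (B + d c)] packets are active. *)
apply: leq_trans Wc; rewrite [leqRHS]mulnC -[D in leqRHS]card_ord -sum_nat_const.
apply: (@leq_trans (\sum_(i < size s) \sum_(j < D) active X i (e.1.1 - j))).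
  by apply: leq_sum => i _; apply: sum_window_le.
by rewrite exchange_big leq_sum // => j _; apply: active_le.
Qed.

End Competitive.

Theorem theorem6p3 :
  forall (d : nat) (C : R), (1 <= d)%N -> Rlt 0 C ->
  exists K : nat, (0 < K)%N /\
  forall (l : 'I_d -> nat) (c B D : nat),
    (forall j, 0 < l j)%N -> (0 < c)%N -> is_diam l D ->
    Rle (Rdiv (INR B) (INR c)) (Rpower (INR (grid_size l)) C) ->
    (k_par (grid_size l) d B c D <= B)%N ->
    (k_par (grid_size l) d B c D <= c)%N ->
    exists ALG : seq (request d) -> execution d,
      online l ALG /\
      forall s : seq (request d), valid_input l s ->
        [/\ feasible l c B s (ALG s),
            no_preemption s (ALG s) &
            forall X : execution d, feasible l c B s X ->
              (throughput s X
                 <= K * (trunc_log 2 (grid_size l)).+1 * throughput s (ALG s))%N].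
Proof.
move=> d C d1 C0; set M := Z.to_nat (Rceil C).
(* This is the ratio [4 * k + 1] with the bound of [k_par_upper] substituted for [k]. *)
exists (4 * (2 * d + M + 9) + 1); split; first by rewrite addn1.
move=> l c B D l0 c0 hD leB kB kc.
have n0 : 0 < grid_size l by rewrite prodn_gt0.
have lower := k_par_lower (grid_size l) d B D c0.
have upper := k_par_upper n0 c0 (diam_le l0 hD) (Rle_trans _ _ _ leB (Rpower_le_expn C n0)).
move: (k_par _ _ _ _ _) kB kc lower upper => k kB kc lower upper.
(* With diameter 0 every valid request has equal ends, so nothing needs routing; the weights, which
   divide by [P], are set up only for positive [D]. *)
have [D0|D0] := posnP D.
  exists (routing l c B k 0); split=> [|s vs]; first exact: online_routing.
  have route0 i : ~~ accepted l c B k 0 s i.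
    apply/negP => acc; have /andP[/and5P[_ _ _ sz _] _] := selectP acc.
    by move: acc sz; rewrite /accepted -size_eq0 -leqn0 => /negP.
  split=> [||X fX].
  - apply: feasible_routing => e; rewrite -[s]take_size count_history // big1 //.
    by move=> i _; have := route0 i; rewrite negbK => /eqP->.
  - exact: no_preemption_routing.
  apply: leq_trans (throughput_le l c B k 0 s X) _; rewrite big1 ?addn0.
    by rewrite leq_pmull // muln_gt0 addn1.
  move=> i _; apply/eqP; rewrite eqb0; apply/negP => /(missedP fX (ltn_ord i))[_ ne _].
  have /(all_nthP (req0 d))/(_ i (ltn_ord i)) : all (valid_request l) s by case/andP: vs.
  by move=> /(diam_gt0 hD)/(_ ne); rewrite D0.
(* Rounding the quotient up to [W] keeps [N * D <= W * c], at an excess of at most [c]. *)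
pose N := grid_size l * (B + d * c); pose W := (N * D %/ c).+1.
have Wc : N * D <= W * c by apply/ltnW/ltn_ceil.
(* After multiplication by [c] the left side is at most [N D + 2 c + c D], and [k_par_lower]
   supplies [c + 6 N D + 6 c D]. *)
have Wk : (W + D).+1 < 2 ^ k.
  rewrite -(ltn_pmul2r c0); apply: leq_trans lower.
  have Wle : W * c <= N * D + c by rewrite mulSn addnC leq_add2r leq_divM.
  have Dc : c <= c * D by rewrite leq_pmulr.
  have -> : 6 * (grid_size l * (d * c + B) + c) * D = 6 * (N * D) + 6 * (c * D).
    by rewrite /N [d * c + B]addnC; ring.
  have ND : 0 < N * D.
    by rewrite !muln_gt0 n0 D0 addn_gt0 muln_gt0 d1 c0 orbT.
  rewrite mulSn mulnDl [D * c]mulnC.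
  by move: (N * D) (c * D) (W * c) Wle Dc ND => *; lia.
have k0 : 0 < k by rewrite lt0n; apply: contraTneq Wk => ->.
exists (routing l c B k (W + D)); split=> [|s vs]; first exact: online_routing.
split=> [||X fX].
- apply: feasible_routing => e; rewrite -[in leqLHS](take_size s).
  by apply: load_le.
- exact: no_preemption_routing.
apply: leq_trans (routing_competitive vs hD k0 kB kc (ltn0Sn _) Wc fX) _.
rewrite leq_mul2r mulnDl -mulnA; apply/orP; right.
by rewrite leq_add ?mul1n // leq_mul2l upper.
Qed.
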